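(* Let $b_{n,p}$ denote the number of permutations of length $n$ in the basis $\mathcal{B}_p$ (equivalently, by the structural characterization, the basis permutations of length $n$ with exactly $p+1$ non-left-to-right-maxima). Then $b_{n,p}=0$ if $p<(n-2)/2$ or $p>n-2$, $b_{n,n-2}=(n-1)!$ for $n>1$, and for $p<n-2$, $$b_{n,p}=\sum_{\ell=0}^{p-1}(\ell+1)!\binom{n-2}{\ell}\,b_{n-\ell-2,\,p-\ell-1}.$$
   Context: A right-jump transforms $\sigma=\sigma_1\cdots\sigma_n$ into $\sigma_1\cdots\sigma_{i-1}\sigma_{i+1}\cdots\sigma_j\sigma_i\sigma_{j+1}\cdots\sigma_n$ for some $1\le i<j\le n$. A left-to-right maximum of $\sigma$ is an entry $\sigma_i$ with $\sigma_k<\sigma_i$ for all $k<i$; every other entry is a non-left-to-right-maximum. A permutation $\pi$ is a pattern of $\sigma$ (written $\pi\prec\sigma$) if some subsequence of $\sigma$ is order-isomorphic to $\pi$. $\mathcal{C}_p$ is the set of all permutations (of any length $n$) obtainable from the identity $12\cdots n$ by at most $p$ right-jumps. The basis $\mathcal{B}_p$ is the set of permutations $\sigma\notin\mathcal{C}_p$ such that every pattern $\pi\prec\sigma$ with $\pi\ne\sigma$ lies in $\mathcal{C}_p$. *)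

(* Defs.v *)
(* Permutations of length n are sequences of nat that are
   rearrangements of [:: 0; 1; ...; n-1] (values shifted by -1 w.r.t. the paper). *)
From mathcomp Require Import all_boot.
Set Implicit Arguments. Unset Strict Implicit. Unset Printing Implicit Defensive.

Definition is_perm (s : seq nat) : bool := perm_eq s (iota 0 (size s)).

(* right-jump, 0-indexed, i < j < size s:
   s_0..s_{i-1} s_{i+1}..s_j s_i s_{j+1}..s_{n-1} *)
Definition rjump (s : seq nat) (i j : nat) : seq nat :=
  take i s ++ take (j - i) (drop i.+1 s) ++ [:: nth 0 s i] ++ drop j.+1 s.

Fixpoint reachb (k : nat) (t s : seq nat) : bool :=
  if k is k'.+1 then
    has (fun i => has (fun j => reachb k' (rjump t i j) s)
                      (iota i.+1 (size t - i.+1)))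
        (iota 0 (size t))
  else t == s.

Definition inC (p : nat) (s : seq nat) : bool :=
  has (fun k => reachb k (iota 0 (size s)) s) (iota 0 p.+1).

Definition order_iso (u v : seq nat) : bool :=
  (size u == size v) &&
  all (fun a => all (fun b => (nth 0 u a < nth 0 u b) == (nth 0 v a < nth 0 v b))
                    (iota 0 (size u)))
      (iota 0 (size u)).

Definition patternb (pi sigma : seq nat) : bool :=
  [exists m : (size sigma).-tuple bool, order_iso (mask m sigma) pi].

(* sigma is in the basis B_p.  Every pattern of sigma has length <= size sigma,
   and the permutations of length k are exactly permutations (iota 0 k). *)
Definition inBasis (p : nat) (sigma : seq nat) : bool :=
  is_perm sigma && ~~ inC p sigma &&
  all (fun k => all (fun pi => patternb pi sigma ==> (pi != sigma) ==> inC p pi)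
                    (permutations (iota 0 k)))
      (iota 0 (size sigma).+1).

Definition b (n p : nat) : nat := count (inBasis p) (permutations (iota 0 n)).

(* Main.v *)
Require Import Defs.
From mathcomp Require Import all_boot zify.
Set Implicit Arguments. Unset Strict Implicit. Unset Printing Implicit Defensive.

(** A right-jump creates at most one non-left-to-right maximum, and any
    non-left-to-right maximum can be removed by undoing one right-jump; hence
    C_p consists of the permutations with at most p non-left-to-right maxima.
    Deleting a non-left-to-right maximum lowers their number by exactly one, so
    the basis permutations are those with p+1 of them in which deleting any
    left-to-right maximum also lowers that number.

    In a permutation u n v of 1..n, deleting the maximum n lowers the number
    iff n-1 lies in v, and the deletion condition at the other left-to-right
    maxima only depends on u, since all entries of v stay below n.  Choosing
    the l entries of v other than n-1, an order of these l+1 entries, and u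
    gives the recurrence. *)

(** * Counting non-left-to-right maxima, and the effect of deletions *)

(** In [nlrm M s], [ess M s] and [bound M s], [s] is read as the continuation of
    a word whose entries are all below the least upper bound [M]: an entry is a
    left-to-right maximum iff it is at least the current bound. *)
Fixpoint nlrm (M : nat) (s : seq nat) : nat :=
  if s is x :: s' then if M <= x then nlrm x.+1 s' else (nlrm M s').+1 else 0.

(** [ess 0 s]: deleting any left-to-right maximum of [s] decreases [nlrm]. *)
Fixpoint ess (M : nat) (s : seq nat) : bool :=
  if s is x :: s' then
    if M <= x then (nlrm M s' < nlrm x.+1 s') && ess x.+1 s' else ess M s'
  else true.

Definition bound (M : nat) (s : seq nat) : nat := foldl (fun m x => maxn m x.+1) M s.

(** An entry [x] with [M <= x < M'] becomes a non-left-to-right maximum, and the bound [x.+1] that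
    it used to set is still at most [M']. *)
Lemma nlrm_mono M M' s : M <= M' -> nlrm M s <= nlrm M' s.
Proof.
elim: s M M' => //= x s IH M M' leMM'.
case: ifP => Mx; case: ifP => M'x //; last by rewrite ltnS IH.
- by rewrite leqW // IH //; lia.
- by lia.
Qed.

Lemma nlrm_cat M u v : nlrm M (u ++ v) = nlrm M u + nlrm (bound M u) v.
Proof.
elim: u M => //= x u IH M; case: leqP => Mx; rewrite IH.
  by rewrite /maxn ltnS Mx.
by rewrite /maxn ltnNge Mx.
Qed.

Lemma bound_lt M s x : (x < bound M s) = (x < M) || has (leq x) s.
Proof.
elim: s M => [|y s IH] M /=; first by rewrite orbF.
by rewrite IH leq_max ltnS orbA.
Qed.

Lemma bound_leP M s x : (bound M s <= x) = (M <= x) && all (ltn^~ x) s.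
Proof.
rewrite leqNgt bound_lt negb_or -leqNgt -all_predC; congr (_ && _).
by apply: eq_all => y /=; rewrite -ltnNge.
Qed.

Lemma nlrm_all_lt M s : all (ltn^~ M) s -> nlrm M s = size s.
Proof. by elim: s => //= x s IH /andP[xM sM]; rewrite leqNgt xM IH. Qed.

Lemma nlrm_size M s : nlrm M s <= size s.
Proof. by elim: s M => //= x s IH M; case: ifP => _; [apply: leqW|]; exact: IH. Qed.

Lemma nlrm_mask M m s : nlrm M (mask m s) <= nlrm M s.
Proof.
elim: s M m => [|x s IH] M [|[] m] //=; case: ifP => Mx; rewrite ?ltnS ?IH //.
  by apply: leq_trans (IH _ m) _; apply: nlrm_mono; lia.
exact: leqW.
Qed.

(** Only the first deleted entry matters: removing it already lowers the count, and by [nlrm_mask]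
    later deletions cannot raise it again. *)
Lemma ess_mask M m s :
  ess M s -> size (mask m s) < size s -> nlrm M (mask m s) < nlrm M s.
Proof.
elim: s M m => [|x s IH] M [|[] m] //=.
- case: ifP => Mx // /andP[lt_s _] _; exact: leq_ltn_trans lt_s.
- by case: ifP => Mx; [case/andP=> _ | ]; rewrite ?ltnS; exact: IH.
- case: ifP => Mx; last by move=> _ _; rewrite ltnS nlrm_mask.
  case/andP=> lt_s _ _; exact: leq_ltn_trans (nlrm_mask _ _ _) lt_s.
Qed.

Lemma ess_deletion M s :
  (forall u x v, s = u ++ x :: v -> nlrm M (u ++ v) < nlrm M s) -> ess M s.
Proof.
elim: s M => //= x s IH M del_s.
have:= del_s [::] x s erefl; case: ifP del_s => Mx del_s /= lt_s.
  by rewrite lt_s IH // => u y v E; have:= del_s (x :: u) y v; rewrite E /= Mx; apply.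
by apply: IH => u y v E; have:= del_s (x :: u) y v; rewrite E /= Mx; apply.
Qed.

Lemma nlrm_map f M M' s :
    {in s &, {mono f : x y / x < y}} -> {in s, forall x, (M <= f x) = (M' <= x)} ->
  nlrm M (map f s) = nlrm M' s.
Proof.
elim: s M M' => //= x s IH M M' fmono fM.
have fmono' : {in s &, {mono f : x y / x < y}}.
  by move=> y z ys zs; apply: fmono; rewrite inE ?ys ?zs orbT.
rewrite fM ?mem_head //; case: ifP => _; last first.
  by congr _.+1; apply: IH => // y ys; rewrite fM // inE ys orbT.
by apply: IH => // y ys; rewrite fmono ?mem_head // inE ys orbT.
Qed.

Lemma ess_map f M M' s :
    {in s &, {mono f : x y / x < y}} -> {in s, forall x, (M <= f x) = (M' <= x)} ->
  ess M (map f s) = ess M' s.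
Proof.
elim: s M M' => //= x s IH M M' fmono fM.
have fmono' : {in s &, {mono f : x y / x < y}}.
  by move=> y z ys zs; apply: fmono; rewrite inE ?ys ?zs orbT.
have fM' : {in s, forall y, (M <= f y) = (M' <= y)}.
  by move=> y ys; rewrite fM // inE ys orbT.
have fx : {in s, forall y, (f x < f y) = (x < y)}.
  by move=> y ys; rewrite fmono ?mem_head // inE ys orbT.
rewrite fM ?mem_head //; case: ifP => _; last exact: IH.
by rewrite (nlrm_map fmono' fM') (nlrm_map fmono' fx) (IH _ _ fmono' fx).
Qed.

Lemma nlrm_gt0 M s : 0 < nlrm M s -> exists u x v, s = u ++ x :: v /\ x < bound M u.
Proof.
elim: s M => //= x s IH M; case: ifP => Mx; last by move=> _; exists [::], x, s; rewrite /= ltnNge Mx.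
case/IH=> u [y [v [-> lt_y]]]; exists (x :: u), y, v; split=> //=.
by rewrite /maxn ltnS Mx.
Qed.

Lemma nlrm_del M u x v : x < bound M u -> nlrm M (u ++ x :: v) = (nlrm M (u ++ v)).+1.
Proof. by move=> lt_x; rewrite !nlrm_cat /= leqNgt lt_x addnS. Qed.

Lemma nlrm0_path x s : nlrm x.+1 s = 0 -> path ltn x s.
Proof. by elim: s x => //= y s IH x; case: ifP => //= xy /IH->. Qed.

Lemma nlrm0_sorted s : nlrm 0 s = 0 -> sorted ltn s.
Proof. case: s => //= x s; exact: nlrm0_path. Qed.

Lemma sorted_nlrm0 s : sorted ltn s -> nlrm 0 s = 0.
Proof.
case: s => //= x s; elim: s x => //= y s IH x /andP[xy /IH]; by rewrite xy.
Qed.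

(** * Right-jumps and the description of [inC] *)

Lemma rjump_cat u x v1 v2 :
  rjump (u ++ x :: v1 ++ v2) (size u) (size u + size v1) = u ++ v1 ++ x :: v2.
Proof.
have drop_x w : drop (size u).+1 (u ++ x :: w) = w.
  by rewrite drop_cat ltnNge leqnSn /= subSnn /= drop0.
have ->: size u + size v1 = size v1 + size u by exact: addnC.
rewrite /rjump take_size_cat // nth_cat ltnn subnn addnK drop_x -addnS -drop_drop drop_x.
by rewrite take_size_cat // drop_size_cat.
Qed.

Lemma rjumpP t i j : i < j < size t ->
  exists (u : seq nat) x (v1 v2 : seq nat), [/\ t = u ++ x :: v1 ++ v2, i = size u & j = size u + size v1].
Proof.
case/andP=> ij jt; have it := ltn_trans ij jt.
exists (take i t), (nth 0 t i), (take (j - i) (drop i.+1 t)), (drop (j - i) (drop i.+1 t)).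
rewrite cat_take_drop -drop_nth // cat_take_drop; split=> //; rewrite !size_takel ?size_drop; lia.
Qed.

(** The jump moves [x] behind [v1]. Without [x] in front, [v1] counts no more than before by
    [nlrm_mono], and [x] itself adds at most one. *)
Lemma nlrm_rjump t i j : i < j < size t -> nlrm 0 (rjump t i j) <= (nlrm 0 t).+1.
Proof.
case/rjumpP=> u [x [v1 [v2 [-> -> ->]]]]; rewrite rjump_cat !(nlrm_cat _ u) -addnS leq_add2l.
(* The bound after the block ignores the order of its entries, so [v2] contributes equally on both
   sides. *)
set M := bound 0 u; have bE: bound M (v1 ++ [:: x]) = bound (maxn M x.+1) v1.
  by rewrite /bound foldl_cat /=; elim: v1 (M) => //= y v IH m; rewrite IH maxnAC.
have ->: v1 ++ x :: v2 = (v1 ++ [:: x]) ++ v2 by rewrite -catA.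
have ->: x :: v1 ++ v2 = (x :: v1) ++ v2 by [].
rewrite !nlrm_cat bE /=; set B := bound _ v1; rewrite -addSn leq_add2r.
have: nlrm M v1 <= nlrm (maxn M x.+1) v1 by apply: nlrm_mono; lia.
case: (leqP M x) => Mx; rewrite /maxn ltnS ?Mx; case: (B <= x); lia.
Qed.

Lemma reachb_nlrm k t s : reachb k t s -> nlrm 0 s <= nlrm 0 t + k.
Proof.
elim: k t => [|k IH] t /=; first by move/eqP->; rewrite addn0.
case/hasP=> i; rewrite mem_iota => it /hasP[j]; rewrite mem_iota => jt /IH.
by have: i < j < size t by [lia]; move/nlrm_rjump; lia.
Qed.

Lemma reachb_step k t i j s : i < j < size t -> reachb k (rjump t i j) s -> reachb k.+1 t s.
Proof.
move=> ijt r /=; apply/hasP; exists i; first by rewrite mem_iota; lia.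
by apply/hasP; exists j => //; rewrite mem_iota; lia.
Qed.

(** [reachb] peels off the first jump, whereas undoing a jump in the target requires appending one
    at the end. *)
Lemma reachb_rjump k t s i j : i < j < size s -> reachb k t s -> reachb k.+1 t (rjump s i j).
Proof.
move=> ijs; elim: k t => [|k IH] t; first by move=> /eqP->; apply: (@reachb_step 0) ijs _ => /=.
case/hasP=> i'; rewrite mem_iota => it /hasP[j']; rewrite mem_iota => jt /IH.
by apply: reachb_step; lia.
Qed.

(* A non-left-to-right maximum moved leftwards to just before the first larger
   entry becomes a left-to-right maximum, and changes the status of no other entry. *)
Lemma undo_rjump s : uniq s -> 0 < nlrm 0 s -> exists s' i j,
  [/\ i < j < size s', s = rjump s' i j, perm_eq s' s & nlrm 0 s = (nlrm 0 s').+1].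
Proof.
move=> uniq_s /nlrm_gt0[u [x [v [Es]]]]; rewrite bound_lt /= => /[dup] has_u.
move: Es => /[swap]; case/split_find => y u1 u2 xy no_u1 Es.
have xNy : x != y.
  apply/eqP=> E; move: uniq_s; rewrite Es E cat_uniq /= mem_cat mem_rcons mem_head.
  by rewrite andbF.
have lexy : y <= x = false by move: xy xNy => /=; lia.
have bu1 : bound 0 u1 <= x.
  by rewrite bound_leP /=; move: no_u1; rewrite -all_predC; apply: sub_all => z /=; rewrite -ltnNge.
have Es' : s = u1 ++ (y :: u2) ++ x :: v by rewrite Es -cats1 -!catA.
exists (u1 ++ x :: (y :: u2) ++ v), (size u1), (size u1 + size (y :: u2)); split.
- by rewrite !size_cat /= size_cat; lia.
- by rewrite rjump_cat.
- by rewrite Es' perm_cat2l -(cat1s x v) -(cat1s x (_ ++ _)) perm_catCA.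
- have yb : bound 0 u1 <= y by lia.
  have xy' : x < y by lia.
  rewrite Es' !nlrm_cat /= bu1 yb xy' nlrm_cat.
  have ->: (maxn (bound 0 u1) y.+1) = y.+1 by lia.
  by rewrite ifF ?addnS //; apply/negbTE; rewrite -ltnNge bound_lt; lia.
Qed.

(** Induction on the count: zero forces a sorted word, hence the identity; otherwise [undo_rjump]
    supplies a last jump from a word with count one less. *)
Lemma reachb_iota s : is_perm s -> reachb (nlrm 0 s) (iota 0 (size s)) s.
Proof.
move E: (nlrm 0 s) => k; elim: k s E => [|k IH] s E s_perm.
  apply/eqP/esym/(irr_sorted_eq ltn_trans ltnn) => [||x]; first exact: nlrm0_sorted.
    exact: iota_ltn_sorted.
  exact: perm_mem.
have uniq_s: uniq s by rewrite (perm_uniq s_perm) iota_uniq.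
case: (undo_rjump uniq_s); rewrite ?E // => s' [i [j [ij Es s's [E']]]].
rewrite -(perm_size s's) Es; apply: reachb_rjump => //; apply: IH => //.
by rewrite /is_perm (perm_size s's) (perm_trans s's).
Qed.

Lemma inC_nlrm p s : is_perm s -> inC p s = (nlrm 0 s <= p).
Proof.
move=> s_perm; apply/hasP/idP => [[k]|le_p].
  rewrite mem_iota => kp /reachb_nlrm; rewrite (@sorted_nlrm0 (iota _ _)) ?iota_ltn_sorted //; lia.
by exists (nlrm 0 s); [rewrite mem_iota; lia | exact: reachb_iota].
Qed.

(** * Order-isomorphism and the description of the basis *)

Lemma order_iso_map u v : uniq u -> order_iso u v ->
  exists2 f, v = map f u & {in u &, {mono f : x y / x < y}}.
Proof.
move=> uniq_u /andP[/eqP Esz /allP iso_uv].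
(* Off [u] this function takes the default value 0, so it is monotone on [u] only. *)
exists (fun x => nth 0 v (index x u)) => [|x y xu yu].
  apply: (@eq_from_nth _ 0) => [|i iv]; first by rewrite size_map.
  by rewrite (nth_map 0) ?Esz // index_uniq ?Esz.
have := iso_uv (index x u); rewrite mem_iota index_mem => /(_ xu)/allP/(_ (index y u)).
by rewrite mem_iota index_mem => /(_ yu)/eqP; rewrite !nth_index.
Qed.

Lemma map_order_iso f s : uniq s -> {in s &, {mono f : x y / x < y}} -> order_iso s (map f s).
Proof.
move=> uniq_s fmono; rewrite /order_iso size_map eqxx /=.
apply/allP=> i; rewrite mem_iota /= => si; apply/allP=> j; rewrite mem_iota /= => sj.
by rewrite !(nth_map 0) // fmono ?mem_nth.
Qed.

Lemma is_perm_uniq s : is_perm s -> uniq s.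
Proof. by move/perm_uniq->; exact: iota_uniq. Qed.

(** An increasing map sends the sorted list of values to a sorted rearrangement of it, so it fixes
    every value. Hence a pattern of full length is the word itself. *)
Lemma mono_is_perm_id f s : is_perm s -> is_perm (map f s) ->
  {in s &, {mono f : x y / x < y}} -> map f s = s.
Proof.
rewrite /is_perm size_map => s_perm fs_perm fmono.
have f_iota : map f (iota 0 (size s)) = iota 0 (size s).
  apply: (irr_sorted_eq ltn_trans ltnn); rewrite ?iota_ltn_sorted //.
    apply: (@homo_sorted_in _ _ (mem s) f ltn); last exact: iota_ltn_sorted.
      by move=> x y xs ys; rewrite /= fmono.
    by apply/allP => x; rewrite -(perm_mem s_perm).
  by apply: perm_mem; apply: perm_trans fs_perm; rewrite perm_sym perm_map.
rewrite -[RHS]map_id; apply/eq_in_map => x; rewrite (perm_mem s_perm).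
by move: x; apply/eq_in_map; rewrite map_id.
Qed.

(** Replacing each entry by its rank is standardization, which turns a subsequence into a genuine
    permutation pattern. *)
Lemma index_sort_mono s : uniq s -> {in s &, {mono index^~ (sort leq s) : x y / x < y}}.
Proof.
move=> uniq_s x y xs ys.
have srt := sort_sorted leq_total s.
have ltx z t : z \in s -> t \in s -> index z (sort leq s) <= index t (sort leq s) -> z <= t.
  move=> zs ts; apply: (sorted_leq_index leq_trans leqnn srt); by rewrite mem_sort.
apply/idP/idP => [lt_xy|]; last by apply: contraTT; rewrite -!leqNgt; exact: ltx.
rewrite ltn_neqAle ltx // ?(ltnW lt_xy) // andbT.
by apply: contraTneq lt_xy => ->; rewrite ltnn.
Qed.

Lemma index_sort_is_perm s : uniq s -> is_perm (map (index^~ (sort leq s)) s).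
Proof.
move=> uniq_s; rewrite /is_perm size_map.
have -> : iota 0 (size s) = map (index^~ (sort leq s)) (sort leq s).
  apply: (@eq_from_nth _ 0); first by rewrite size_map size_sort size_iota.
  move=> i; rewrite size_iota => si; rewrite nth_iota // (nth_map 0) ?size_sort //.
  by rewrite index_uniq ?size_sort ?sort_uniq.
by apply: perm_map; rewrite perm_sym perm_sort.
Qed.

Lemma nlrm_order_iso u v : uniq u -> order_iso u v -> nlrm 0 v = nlrm 0 u.
Proof. by move=> uniq_u /(order_iso_map uniq_u)[f -> fmono]; exact: nlrm_map. Qed.

Lemma basis_pattern p s pi : inBasis p s -> is_perm pi -> size pi <= size s ->
  patternb pi s -> pi != s -> nlrm 0 pi <= p.
Proof.
case/andP=> _ /allP pat pi_perm sz_pi pi_s piNs.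
have := pat (size pi); rewrite mem_iota /= ltnS => /(_ sz_pi)/allP/(_ pi).
by rewrite mem_permutations pi_s piNs inC_nlrm //; apply.
Qed.

Lemma basis_deletion p u x v : inBasis p (u ++ x :: v) -> nlrm 0 (u ++ v) <= p.
Proof.
move=> basis_s; have s_perm: is_perm (u ++ x :: v) by case/andP: basis_s => /andP[].
have uniq_uv : uniq (u ++ v).
  by apply: subseq_uniq (is_perm_uniq s_perm); rewrite cat_subseq ?subseq_refl ?subseq_cons.
have mono_uv := index_sort_mono uniq_uv.
have szE : size (map (index^~ (sort leq (u ++ v))) (u ++ v)) < size (u ++ x :: v).
  by rewrite size_map !size_cat /= addnS.
rewrite -(nlrm_order_iso uniq_uv (map_order_iso uniq_uv mono_uv)).
apply: basis_pattern basis_s _ (ltnW szE) _ _.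
- exact: index_sort_is_perm.
- apply/existsP; have sz_m: size (nseq (size u) true ++ false :: nseq (size v) true) == size (u ++ x :: v).
    by rewrite !size_cat /= !size_nseq.
  exists (Tuple sz_m) => /=; rewrite mask_cat ?size_nseq //= !mask_true //.
  exact: map_order_iso.
- by apply: contraTneq szE => ->; rewrite ltnn.
Qed.

(** Deleting a non-left-to-right maximum costs exactly one and must leave at most [p], so the count
    is [p.+1]; every other deletion must lower it too, which is [ess]. Conversely, a proper pattern
    omits an entry, and [ess_mask] applies. *)
Lemma inBasis_ess p s : is_perm s -> inBasis p s = (nlrm 0 s == p.+1) && ess 0 s.
Proof.
move=> s_perm; apply/idP/andP => [basis_s | [/eqP nlrm_s ess_s]].
  have: ~~ inC p s by case/andP: basis_s => /andP[].
  rewrite inC_nlrm // -ltnNge => lt_p.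
  have [u [x [v [Es xu]]]] := nlrm_gt0 (leq_ltn_trans (leq0n p) lt_p).
  have:= basis_s; rewrite Es => /basis_deletion; rewrite -ltnS -(nlrm_del v xu) -Es => le_p.
  have Ep : nlrm 0 s = p.+1 by apply/eqP; rewrite eqn_leq le_p lt_p.
  split; first exact/eqP.
  apply: ess_deletion => u' y v' Es'; rewrite Ep ltnS.
  by apply: (@basis_deletion p u' y v'); rewrite -Es'.
rewrite /inBasis s_perm inC_nlrm // nlrm_s ltnn andTb.
apply/allP=> k _; apply/allP=> pi; rewrite mem_permutations => pi_k.
apply/implyP=> /existsP[m iso_m]; apply/implyP=> piNs.
have pi_perm : is_perm pi by rewrite /is_perm (perm_size pi_k) size_iota.
have uniq_m : uniq (mask m s) by rewrite mask_uniq ?is_perm_uniq.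
rewrite inC_nlrm // (nlrm_order_iso uniq_m iso_m) -ltnS -nlrm_s; apply: ess_mask => //.
rewrite ltn_neqAle size_subseq ?mask_subseq // andbT; apply: contraNneq piNs => sz_m.
have Em : mask m s = s by apply/eqP; rewrite -size_subseq_leqif ?mask_subseq //; apply/eqP.
rewrite Em in iso_m; have [f Epi fmono] := order_iso_map (is_perm_uniq s_perm) iso_m.
by rewrite Epi mono_is_perm_id // -Epi.
Qed.

(** * Counting words over an arbitrary set of values *)

Definition ess_count (t : seq nat) (q : nat) : nat :=
  count (fun s => (nlrm 0 s == q) && ess 0 s) (permutations t).

Lemma b_ess_count n p : b n p = ess_count (iota 0 n) p.+1.
Proof.
apply: eq_in_count => s; rewrite mem_permutations => s_n.
by rewrite inBasis_ess // /is_perm (perm_size s_n) size_iota.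
Qed.

Lemma ess_count_perm t t' q : perm_eq t t' -> ess_count t q = ess_count t' q.
Proof. by move=> tt'; exact/seq.permP/perm_permutations. Qed.

Lemma perm_permutations_nth (T : eqType) (x0 : T) t : uniq t ->
  perm_eq (permutations t) (map (map (nth x0 t)) (permutations (iota 0 (size t)))).
Proof.
move=> uniq_t; apply: uniq_perm; first exact: permutations_uniq.
  rewrite map_inj_in_uniq ?permutations_uniq // => w w'; rewrite !mem_permutations => wt w't E.
  have nthK w1 : perm_eq w1 (iota 0 (size t)) -> map (index^~ t) (map (nth x0 t) w1) = w1.
    move=> w1t; rewrite -map_comp -[RHS]map_id; apply/eq_in_map => i.
    by rewrite (perm_mem w1t) mem_iota /= => it; rewrite index_uniq.
  by rewrite -(nthK w) // E nthK.
move=> w; rewrite mem_permutations; apply/(perm_iotaP x0)/mapP => -[v].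
  by move=> vt ->; exists v; rewrite ?mem_permutations.
by rewrite mem_permutations => vt ->; exists v.
Qed.

(** Sorting the values makes [nth 0 t'] increasing on positions, so a word of positions and its
    image have the same [nlrm] and [ess]. *)
Lemma ess_count_iota t q : uniq t -> ess_count t q = ess_count (iota 0 (size t)) q.
Proof.
move=> uniq_t; rewrite -(@ess_count_perm (sort leq t)); last by rewrite perm_sort.
rewrite -(size_sort leq); set t' := sort leq t.
have uniq_t' : uniq t' by rewrite sort_uniq.
have nth_mono : {in iota 0 (size t') &, {mono nth 0 t' : i j / i < j}}.
  move=> i j; rewrite !mem_iota /= => it jt.
  rewrite -(index_sort_mono uniq_t') ?mem_nth // sorted_sort ?sort_sorted //; last first.
  - exact: leq_total.
  - exact: leq_trans.
  by rewrite !index_uniq.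
rewrite /ess_count (seq.permP (perm_permutations_nth 0 uniq_t')) count_map.
apply: eq_in_count => s; rewrite mem_permutations => st /=.
have smono : {in s &, {mono nth 0 t' : x y / x < y}}.
  by move=> x y; rewrite !(perm_mem st); exact: nth_mono.
by rewrite (nlrm_map (M' := 0) smono) // (ess_map (M' := 0) smono).
Qed.

Lemma nlrm_lt_size M s : (nlrm M s < size s) = has (leq M) s.
Proof. by elim: s M => //= x s IH M; case: ifP => _; rewrite ltnS ?nlrm_size ?IH. Qed.

(** With [x] present all of [v] counts, so deleting [x] lowers the count iff some entry of [v]
    reaches the bound left by [u]. The conditions inside [u] do not see [x :: v], which contributes
    [size v] in any case. *)
Lemma ess_cat_max M u x v :
    M <= x -> all (ltn^~ x) u -> all (ltn^~ x) v ->
  ess M (u ++ x :: v) = ess M u && has (leq (bound M u)) v.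
Proof.
move=> + + vx; rewrite -nlrm_lt_size.
have vx' : all (ltn^~ x.+1) v by apply: sub_all vx => y /= ?; lia.
have ltx_nlrm z w : all (ltn^~ x) w -> z <= x -> nlrm z (w ++ x :: v) = nlrm z w + size v.
  by move=> wx zx; rewrite nlrm_cat /= bound_leP zx wx (nlrm_all_lt vx').
have ess_v z : all (ltn^~ z) v -> ess z v.
  by elim: (v) => //= y w IH /andP[yz /IH]; rewrite leqNgt yz.
elim: u M => [|y u IH] M Mx /=; first by rewrite Mx ess_v // andbT (nlrm_all_lt vx').
case/andP=> yx ux; case: (leqP M y) => My; rewrite IH //.
  by rewrite !ltx_nlrm // ltn_add2r andbA /maxn ltnS My.
by rewrite (maxn_idPl My).
Qed.

(** * Splitting a permutation at its maximum *)

Section Split.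

Variable N : nat.
Implicit Types (A : {set 'I_N}) (w u v : seq nat).

Definition ords A : seq nat := map val (enum A).

Lemma mem_ords A x : reflect (exists2 i, i \in A & x = val i) (x \in ords A).
Proof.
by apply: (iffP mapP) => -[i]; rewrite ?mem_enum => iA ->; exists i; rewrite ?mem_enum.
Qed.

Lemma ords_uniq A : uniq (ords A).
Proof. by rewrite map_inj_uniq ?enum_uniq //; exact: val_inj. Qed.

Lemma size_ords A : size (ords A) = #|A|.
Proof. by rewrite size_map -cardE. Qed.

(** [left_set w] and [splits A] encode a permutation [u ++ N.+1 :: v] of [0..N+1]
    with [N] in [v] by the set [A] of entries of [u]. *)
Definition left_set w : {set 'I_N} := [set i : 'I_N | val i \in take (index N.+1 w) w].

Definition splits A : seq (seq nat) :=
  [seq u ++ N.+1 :: v | u <- permutations (ords A), v <- permutations (N :: ords (~: A))].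

Lemma mem_iotaSS x : (x \in iota 0 N.+2) = [|| x == N.+1, x == N | x < N].
Proof. rewrite mem_iota; lia. Qed.

Lemma ords_lt A x : x \in ords A -> x < N.
Proof. by case/mem_ords=> i _ ->; exact: ltn_ord. Qed.

Lemma splits_lt A u v : perm_eq u (ords A) -> perm_eq v (N :: ords (~: A)) ->
  all (ltn^~ N) u /\ all (ltn^~ N.+1) v.
Proof.
move=> uA vA; split; apply/allP=> x; first by rewrite (perm_mem uA) => /ords_lt.
by rewrite (perm_mem vA) inE => /orP[/eqP-> //|/ords_lt]; rewrite /=; lia.
Qed.

Lemma ess_split A u v : perm_eq u (ords A) -> perm_eq v (N :: ords (~: A)) ->
  ess 0 (u ++ N.+1 :: v) = ess 0 u.
Proof.
move=> uA vA; have [uN vN] := splits_lt uA vA.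
rewrite ess_cat_max //; last by apply: sub_all uN => x /= ?; lia.
apply/andb_idr => _; apply/hasP; exists N; first by rewrite (perm_mem vA) mem_head.
by rewrite bound_leP.
Qed.

Lemma nlrm_split A u v : perm_eq u (ords A) -> perm_eq v (N :: ords (~: A)) ->
  nlrm 0 (u ++ N.+1 :: v) = nlrm 0 u + (N - #|A|).+1.
Proof.
move=> uA vA; have [uN vN] := splits_lt uA vA.
have vN' : all (ltn^~ N.+2) v by apply: sub_all vN => x /= ?; lia.
rewrite nlrm_cat /= (nlrm_all_lt vN') bound_leP ifT; last first.
  by apply: sub_all uN => x /= ?; lia.
by rewrite (perm_size vA) /= size_ords cardsCs setCK card_ord.
Qed.

Lemma splits_uniq A : uniq (splits A).
Proof.
apply: allpairs_uniq; rewrite ?permutations_uniq // => -[u v] [u' v'].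
case/allpairsP=> -[u1 v1] /=; rewrite !mem_permutations => -[uA vA [-> ->]].
case/allpairsP=> -[u2 v2] /=; rewrite !mem_permutations => -[uA' vA' [-> ->]] /eqP.
(* Every [u] has the length of [ords A], so the place of the cut is determined. *)
rewrite eqseq_cat; last by rewrite (perm_size uA) (perm_size uA').
by case/andP=> /eqP-> /eqP[->].
Qed.

Lemma index_split A u v : perm_eq u (ords A) -> index N.+1 (u ++ N.+1 :: v) = size u.
Proof.
move=> uA; rewrite index_cat /= eqxx addn0 ifN //.
by rewrite (perm_mem uA); apply/negP=> /ords_lt; lia.
Qed.

Lemma left_set_split A u v : perm_eq u (ords A) -> left_set (u ++ N.+1 :: v) = A.
Proof.
move=> uA; apply/setP=> i; rewrite inE (index_split _ uA) take_size_cat // (perm_mem uA).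
by apply/mem_ords/idP => [[j jA /val_inj->] //|iA]; exists i.
Qed.

Lemma perm_split A u v : perm_eq u (ords A) -> perm_eq v (N :: ords (~: A)) ->
  perm_eq (u ++ N.+1 :: v) (iota 0 N.+2).
Proof.
move=> uA vA; rewrite -addn2 iotaD.
apply: (@perm_trans _ ([:: N.+1; N] ++ ords A ++ ords (~: A))).
  by rewrite perm_sym perm_catCA perm_sym perm_cat // perm_cons.
rewrite perm_sym perm_catC perm_cat //; first by rewrite (perm_catC [:: N] [:: N.+1]).
rewrite -val_enum_ord perm_sym -map_cat perm_map //.
apply: uniq_perm; rewrite ?enum_uniq //.
  rewrite cat_uniq !enum_uniq andbT; apply/hasPn => i.
  by rewrite !mem_enum inE.
by move=> i; rewrite mem_cat !mem_enum inE orbN.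
Qed.

Lemma splitting w : perm_eq w (iota 0 N.+2) -> ess 0 w -> w \in splits (left_set w).
Proof.
move=> wN ess_w; have uniq_w : uniq w by rewrite (perm_uniq wN) iota_uniq.
have mem_w x : (x \in w) = [|| x == N.+1, x == N | x < N] by rewrite (perm_mem wN) mem_iotaSS.
have Nw : N.+1 \in w by rewrite mem_w eqxx.
case/splitPr: w / Nw wN ess_w uniq_w mem_w => u v wN ess_w uniq_w mem_w.
move: (uniq_w); rewrite cat_uniq /= negb_or -andbA => /and5P[uniq_u Nu vu Nv uniq_v].
have mem_u x : x \in u -> (x == N) || (x < N).
  move=> xu; have := mem_w x; rewrite mem_cat xu; case: eqP => [Ex|//].
  by rewrite -Ex xu in Nu.
have mem_v x : x \in v -> (x == N) || (x < N).
  move=> xv; have := mem_w x; rewrite mem_cat inE xv !orbT; case: eqP => [Ex|//].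
  by rewrite -Ex xv in Nv.
(* If [N] stood in [u], the bound left by [u] would exceed all of [v], against the condition at the
   maximum [N.+1]. *)
have Nu' : N \notin u.
  move: ess_w; rewrite ess_cat_max //; last 2 first.
  - by apply/allP=> x /mem_u /=; lia.
  - by apply/allP=> x /mem_v /=; lia.
  case/andP=> _ /hasP[y yv]; apply: contraTN => uN.
  have := mem_v y yv; rewrite -ltnNge bound_lt => /orP[/eqP->|yN]; apply/hasP.
    by exists N.
  by exists N => //; exact: ltnW.
have Nv' : N \in v by have := mem_w N; rewrite mem_cat inE (negbTE Nu') eqxx orbT; case: eqP => // /n_Sn.
have mem_left i : (i \in left_set (u ++ N.+1 :: v)) = (val i \in u).
  by rewrite inE index_cat (negbTE Nu) /= eqxx addn0 take_size_cat.
apply/allpairsP; exists (u, v) => /=; rewrite !mem_permutations; split=> //.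
  apply: uniq_perm => // [|x]; first exact: ords_uniq.
  apply/idP/mem_ords => [xu|[i]]; last by rewrite mem_left => iu ->.
  have xN : x < N by case/orP: (mem_u x xu) => // /eqP Ex; rewrite -Ex xu in Nu'.
  by exists (Ordinal xN) => //; rewrite mem_left.
apply: uniq_perm => // [|x].
  by rewrite /= ords_uniq andbT; apply/negP=> /ords_lt; rewrite ltnn.
rewrite inE; apply/idP/orP => [xv|[/eqP->//|/mem_ords[i]]].
  case/orP: (mem_v x xv) => [->|xN]; [by left | right].
  apply/mem_ords; exists (Ordinal xN) => //; rewrite inE mem_left.
  by apply: contra vu => xu; apply/hasP; exists x.
rewrite inE mem_left => iu ->; have := mem_w (val i).
have iN : (val i == N.+1) = false by exact: ltn_eqF (leqW (ltn_ord i)).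
by rewrite mem_cat inE (negbTE iu) iN ltn_ord !orbT.
Qed.

Lemma perm_filter_splits q A :
  perm_eq [seq w <- permutations (iota 0 N.+2) | (nlrm 0 w == q) && ess 0 w && (left_set w == A)]
          [seq w <- splits A | (nlrm 0 w == q) && ess 0 w].
Proof.
apply: uniq_perm; rewrite ?filter_uniq ?permutations_uniq ?splits_uniq // => w.
rewrite !mem_filter mem_permutations; apply/andP/andP => [[/andP[qw /eqP EA] wN] | [qw]].
  by split=> //; rewrite -EA; apply: splitting => //; case/andP: qw.
case/allpairsP=> -[u v] /=; rewrite !mem_permutations => -[uA vA Ew]; rewrite qw Ew.
by rewrite (left_set_split _ uA) eqxx (perm_split uA vA).
Qed.

(** [ess] sees only [u], and all of [v] counts, so each admissible [u] occurs once per order of [v].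
    The factor [N - #|A| < q] guards against the truncated subtraction from [q]. *)
Lemma count_splits q A :
  count (fun w => (nlrm 0 w == q) && ess 0 w) (splits A) =
    (N - #|A|).+1`! * ((N - #|A| < q) * ess_count (iota 0 #|A|) (q - (N - #|A|).+1)).
Proof.
set k := (N - #|A|).+1.
rewrite -sum1_count big_mkcond big_allpairs_dep /= -(size_ords A) -ess_count_iota ?ords_uniq //.
rewrite /ess_count -sum1_count [in RHS]big_mkcond !big_distrr /=.
apply: eq_big_seq => u; rewrite mem_permutations => uA.
transitivity (\sum_(v <- permutations (N :: ords (~: A)))
   (k <= q) * (if (nlrm 0 u == q - k) && ess 0 u then 1 else 0)).
  apply: eq_big_seq => v; rewrite mem_permutations => vA.
  rewrite (ess_split uA vA) (nlrm_split uA vA) -/k.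
  case: (leqP k q) => kq; last by rewrite mul0n ifF //; apply/negbTE; lia.
  by rewrite mul1n -[in RHS](eqn_add2r k) subnK.
rewrite big_const_seq count_predT iter_addn_0 mulnC; congr (_ * _).
rewrite size_permutations /= ?size_ords ?ords_uniq ?andbT.
  by rewrite /k (cardsCs A) card_ord subKn // -[X in _ <= X]card_ord max_card.
by apply/negP=> /ords_lt; rewrite ltnn.
Qed.

(** The index [l] is the number of entries other than [N] to the right of the maximum, that is, the
    size of the complement of [A]. *)
Lemma ess_count_rec q :
  ess_count (iota 0 N.+2) q =
  \sum_(l < N.+1 | l < q) l.+1`! * 'C(N, l) * ess_count (iota 0 (N - l)) (q - l.+1).
Proof.
rewrite /ess_count -sum1_count (partition_big left_set predT) //=.
transitivity (\sum_(A : {set 'I_N})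
    (N - #|A|).+1`! * ((N - #|A| < q) * ess_count (iota 0 #|A|) (q - (N - #|A|).+1))).
  apply: eq_bigr => A _; rewrite -count_splits sum1_count -!size_filter.
  exact/perm_size/perm_filter_splits.
rewrite (partition_big (fun A : {set 'I_N} => inord (N - #|A|) : 'I_N.+1) predT) //=.
rewrite [RHS]big_mkcond; apply: eq_bigr => l _.
have le_card A : #|A| <= N by rewrite -[X in _ <= X]card_ord max_card.
have lN : l <= N by rewrite -ltnS.
have cardE A : (inord (N - #|A|) == l) = (#|A| == N - l).
  rewrite -val_eqE /= inordK ?ltnS ?leq_subr //; move: (le_card A) lN.
  by move: #|A| (nat_of_ord l) => a m; lia.
rewrite (eq_bigl _ _ cardE).
rewrite (eq_bigr (fun=> l.+1`! * ((l < q) * ess_count (iota 0 (N - l)) (q - l.+1)))); last first.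
  by move=> A /eqP->; rewrite subKn.
have -> : \sum_(A : {set 'I_N} | #|A| == N - l) l.+1`! * ((l < q) * ess_count (iota 0 (N - l)) (q - l.+1))
  = 'C(N, l) * (l.+1`! * ((l < q) * ess_count (iota 0 (N - l)) (q - l.+1))).
  rewrite -(bin_sub lN) -[X in 'C(X, _)]card_ord -card_draws -sum_nat_const.
  by apply: eq_bigl => A; rewrite inE.
by case: ifP => _; rewrite ?mul0n ?muln0 // mul1n mulnCA mulnA.
Qed.

End Split.

(** * Vanishing range and the final formulas *)

Lemma ess_count_eq0 n q : 0 < n -> 2 * q < n \/ n <= q -> ess_count (iota 0 n) q = 0.
Proof.
(* The only word of length one fails [ess]: deleting its entry leaves the count at zero. *)
elim/ltn_ind: n q => -[|[|N]] IH q // _ qn; first by rewrite /ess_count /= andbF.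
(* Both alternatives pass from [(N.+2, q)] to [(N - l, q - l.+1)], so induction applies unless [u]
   is empty. *)
rewrite ess_count_rec big1 // => l lq; have lN := ltn_ord l.
have [E|Nl] := posnP (N - l); last by rewrite IH ?muln0 //; lia.
(* An empty [u] contributes only for [q = N.+1], which both alternatives exclude. *)
rewrite E /ess_count /=; case: eqP => [|_]; rewrite ?muln0 //; lia.
Qed.

Theorem mainTheorem7 :
  (forall n p : nat, (2 * p + 2 < n \/ n < p + 2) -> b n p = 0) /\
  (forall n : nat, 1 < n -> b n (n - 2) = (n - 1)`!) /\
  (forall n p : nat, p + 2 < n ->
     b n p = \sum_(0 <= l < p) (l.+1)`! * 'C(n - 2, l) * b (n - l - 2) (p - l - 1)).
Proof.
split; [|split].
- move=> n p np; rewrite b_ess_count; case: (posnP n) => [->|n_gt0]; first by [].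
  by apply: ess_count_eq0 => //; lia.
- case=> [|[|N]] // _; rewrite b_ess_count !subSS !subn0 ess_count_rec.
  (* Only [l = N], with [u] empty, survives: for [l < N] the remaining length equals the required
     count, which is out of range. *)
  rewrite big_mkcond big_ord_recr /= ltnSn subnn subnn binn muln1 big1 ?add0n ?muln1 // => l _.
  have lN := ltn_ord l; rewrite ess_count_eq0 ?muln0 ?if_same //; lia.
- case=> [|[|N]] p pN; try lia.
  rewrite b_ess_count ess_count_rec big_mkord.
  rewrite -(big_ord_widen N.+1 (fun l => l.+1`! * 'C(N, l) * ess_count (iota 0 (N - l)) (p.+1 - l.+1))); last lia.
  (* The term [l = p] asks for count zero on the positive length [N - p], so it vanishes and the sum
     stops below [p]. *)
  rewrite big_ord_recr /= ess_count_eq0 ?muln0 ?addn0; [|lia..].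
  apply: eq_bigr => l _; rewrite b_ess_count; have lp := ltn_ord l.
  by congr (_ * 'C(_, _) * ess_count (iota 0 _) _); lia.
Qed.
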